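(* Let $k$ be an even positive integer and let $c_2\leq c_3$ be positive integers. Then the petal graph $P_{1,c_2,c_3}$ can be embedded in $K_k^*$ if and only if $k\geq6$, $c_2\geq3$, and $1+c_2+c_3\leq\frac{k^2}{2}$.
   Context: $K_k^*$ denotes the complete graph $K_k$ on vertices $v_0,\dotsc,v_{k-1}$ with a loop $v_iv_i$ added at every vertex. An embedding of a graph $G$ (simple graph possibly with at most one loop per vertex) in $K_k^*$ is a map $f:V(G)\to V(K_k^* )$ such that each edge $uv$ of $G$ is sent to the edge $f(u)f(v)$ of $K_k^*$ (a loop if $f(u)=f(v)$), and the induced map $E(G)\to E(K_k^* )$ is injective. The petal graph $P_{1,c_2,c_3}$ consists of a vertex $u_0$ with a loop at $u_0$, together with a cycle $u_0u^2_1\dotsb u^2_{c_2-1}u_0$ of length $c_2$ and a cycle $u_0u^3_1\dotsb u^3_{c_3-1}u_0$ of length $c_3$, these sharing only $u_0$. *)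

(* Defs.v *)
From mathcomp Require Import all_boot.

Set Implicit Arguments.
Unset Strict Implicit.
Unset Printing Implicit Defensive.

(* Finite undirected multigraphs.  The edges form a type of their own, so that *)
(* parallel edges and several loops at a vertex remain distinct: a cycle of    *)
(* length 2 has two edges, and a cycle of length 1 is a loop.                  *)
Record mgraph := MGraph {
  vert : finType;
  edge : finType;
  ends : edge -> {set vert};
  (* [ends e] is a singleton exactly when [e] is a loop. *)
  ends_card : forall e, 0 < #|ends e| <= 2
}.

(* In K_k^* an edge is determined by its ends, so there [phi] is determined by *)
(* [f]: it is the map on edges induced by [f].                                 *)
Definition is_embedding (G H : mgraph) (f : vert G -> vert H) : Prop :=
  exists2 phi : edge G -> edge H,
    forall e, ends (phi e) = f @: ends e & injective phi.

Definition embeddable (G H : mgraph) : Prop :=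
  exists f : vert G -> vert H, is_embedding f.

(* K_k^*: one edge for each set of one (loop) or two vertices. *)
Definition looped_complete (k : nat) : mgraph :=
  @MGraph 'I_k {A : {set 'I_k} | 0 < #|A| <= 2} val (fun e => valP e).

Section Petal.

Variables c2 c3 : nat.

(* [None] is u_0; [Some (inl j)] is u^2_(j+1) and [Some (inr j)] is u^3_(j+1). *)
Definition petal_vert : finType := option ('I_c2.-1 + 'I_c3.-1).

(* [None] is the loop at u_0; [Some (inl i)] joins u^2_i to u^2_(i+1), and     *)
(* [Some (inr i)] joins u^3_i to u^3_(i+1).                                    *)
Definition petal_edge : finType := option ('I_c2 + 'I_c3).

(* The vertices u^2_i and u^3_i, where u^2_0 = u^2_c2 = u_0 and                *)
(* u^3_0 = u^3_c3 = u_0: [insub j] is [None] as soon as c.-1 <= j.             *)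
Definition petal_u2 (i : nat) : petal_vert :=
  if i is j.+1 then omap inl (insub j) else None.

Definition petal_u3 (i : nat) : petal_vert :=
  if i is j.+1 then omap inr (insub j) else None.

Definition petal_ends (e : petal_edge) : {set petal_vert} :=
  match e with
  | None => [set None; None]
  | Some (inl i) => [set petal_u2 i; petal_u2 i.+1]
  | Some (inr i) => [set petal_u3 i; petal_u3 i.+1]
  end.

Lemma petal_ends_card e : 0 < #|petal_ends e| <= 2.
Proof. by case: e => [[i|i]|]; rewrite cards2; case: (_ != _). Qed.

(* The petal graph P_{1,c2,c3}. *)
Definition petal : mgraph := MGraph petal_ends_card.

End Petal.

(* Main.v *)
(* Necessity: let h(v) be the number of times the petal graph visits v.  The   *)
(* edges at v in the image have total degree 2h(v), loops counting twice, and  *)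
(* this is at most k + 1; as k is even, h(v) <= k/2.  Since h is at least 3 at *)
(* the image of u_0, k >= 6, and summing over v bounds the number of edges.    *)
(* Sufficiency: two disjoint closed trails through 0 in K_k^* extend to        *)
(* K_(k+2)^*: the edges from the two new vertices to the old ones split into   *)
(* 4-cycles, so that the longer trail can be lengthened by 4i edges, 0 < i <=  *)
(* k/2, plus at most two new loops.  Induction on k leaves only k = 6 and      *)
(* three pairs of lengths for k = 8.                                           *)

Require Import Defs.
From mathcomp Require Import all_boot zify.

(** Sending u_0 to 0 turns the two cycles into edge-disjoint closed trails through 0 that avoid the
    loop at 0. [tours_embeddable] converts such trails into an embedding, and [has_tours_max]
    supplies them. With k = 2m the condition on the lengths is a + b < 2m^2. Going from m to m + 1
    raises this bound by 4m + 2, which is exactly the largest detour: all 4m edges between old and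
    new vertices, plus two loops. Every degree k + 1 is odd, so each vertex must miss an edge. For
    necessity, [degree_bound] limits the visits to each vertex. *)

(** * Closed trails as lists of vertices *)

Definition uedge (x y : nat) : nat * nat := (minn x y, maxn x y).

Lemma uedgeC x y : uedge x y = uedge y x.
Proof. by rewrite /uedge minnC maxnC. Qed.

Lemma uedge_le x y : x <= y -> uedge x y = (x, y).
Proof. by rewrite /uedge => le_xy; rewrite (minn_idPl le_xy) (maxn_idPr le_xy). Qed.

(* A closed trail through the vertex 0 is given by the list [w] of vertices    *)
(* between the initial 0 and the final 0.                                      *)
Definition tour (w : seq nat) : seq (nat * nat) := pairmap uedge 0 (rcons w 0).

(* The vertex 0 is the image of u_0, so its loop (0, 0) is already taken. *)
Definition disjoint_tours (k : nat) (s t : seq nat) : bool :=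
  all (gtn k) (s ++ t) && uniq ((0, 0) :: tour s ++ tour t).

Definition has_tours (k a b : nat) : Prop :=
  exists s t, [/\ (size s).+1 = a, (size t).+1 = b & disjoint_tours k s t].

Lemma has_tours_sym k a b : has_tours k a b -> has_tours k b a.
Proof.
case=> s [t [sa tb /andP[lt_k /= /andP[n00 u_st]]]]; exists t, s; split=> //.
rewrite /disjoint_tours (perm_all _ (permEl (perm_catC t s))) lt_k /=.
by rewrite uniq_catC u_st mem_cat orbC -mem_cat n00.
Qed.

Lemma has_tours_widen k l a b : k <= l -> has_tours k a b -> has_tours l a b.
Proof.
move=> le_kl [s [t [sa tb /andP[lt_k u_st]]]]; exists s, t; split=> //.
apply/andP; split=> //; apply: sub_all lt_k => x /= lt_xk.
exact: leq_trans le_kl.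
Qed.

Lemma tour_cat s t : tour (s ++ 0 :: t) = tour s ++ tour t.
Proof. by rewrite /tour rcons_cat rcons_cons -cat_rcons pairmap_cat last_rcons. Qed.

Lemma size_tour w : size (tour w) = (size w).+1.
Proof. by rewrite size_pairmap size_rcons. Qed.

Lemma tour_bound k w p : 0 < k -> all (gtn k) w -> p \in tour w -> p.2 < k.
Proof.
move=> k_gt0 /allP lt_wk /(nthP (0, 0))[i]; rewrite size_tour => lt_iw <-.
have lt_nth j : nth 0 (0 :: rcons w 0) j < k.
  have [lt_j | le_j] := ltnP j (size (0 :: rcons w 0)); last by rewrite nth_default.
  have:= mem_nth 0 lt_j; rewrite inE mem_rcons inE orbA orbb.
  by case/orP=> [/eqP-> // | /lt_wk].
rewrite (nth_pairmap 0) ?size_rcons //= gtn_max lt_nth.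
exact: (lt_nth i.+1).
Qed.

(** * Lengthening a trail through two new vertices *)

(** Successive 4-cycles k, 2i+2, k+1, 2i+3, each starting and ending at k. The old vertices 0 and 1
    are left for the 4-cycle of [detour]. *)
Fixpoint zigzag (k j : nat) : seq nat :=
  if j is i.+1 then zigzag k i ++ [:: i.*2.+2; k.+1; i.*2.+3; k] else [::].

(* The 4-cycle 0, k, 1, k.+1, into which the 4-cycles of the zigzag are spliced *)
(* at [k]; [e <= 2] is the number of loops at the two new vertices.            *)
Definition detour (k j e : nat) : seq nat :=
  (k :: nseq (0 < e) k) ++ zigzag k j ++ [:: 1, k.+1 & nseq (1 < e) k.+1].

Lemma last_zigzag k j : last k (zigzag k j) = k.
Proof. by case: j => //= j; rewrite last_cat. Qed.

Lemma size_zigzag k j : size (zigzag k j) = 4 * j.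
Proof. by elim: j => //= j IHj; rewrite size_cat IHj /=; lia. Qed.

Lemma size_detour k j e : e <= 2 -> (size (detour k j e)).+1 = 4 * j.+1 + e.
Proof. by rewrite size_cat /= size_cat /= size_zigzag !size_nseq; lia. Qed.

Lemma zigzag_edges k j : j.*2.+2 <= k ->
  perm_eq (pairmap uedge k (zigzag k j))
    ([seq (i, k) | i <- iota 2 j.*2] ++ [seq (i, k.+1) | i <- iota 2 j.*2]).
Proof.
elim: j => // j IHj; rewrite doubleS => le_jk; rewrite [zigzag _ _]/=.
rewrite -[X in iota _ X]addn2 !iotaD !map_cat pairmap_cat last_zigzag /=.
apply/permP=> a; rewrite count_cat (permP (IHj _)); last by lia.
rewrite !count_cat /= !add2n (uedgeC k) (uedgeC k.+1) !uedge_le; try lia.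
Qed.

Lemma detour_edges k j e : e <= 2 -> j.+1.*2 <= k ->
  perm_eq (tour (detour k j e))
    ([seq (i, k) | i <- iota 0 j.+1.*2] ++ [seq (i, k.+1) | i <- iota 0 j.+1.*2]
     ++ nseq (0 < e) (k, k) ++ nseq (1 < e) (k.+1, k.+1)).
Proof.
move=> e_le2 le_jk; apply/permP=> a.
have ->: tour (detour k j e) = (0, k) :: nseq (0 < e) (k, k) ++
    pairmap uedge k (zigzag k j) ++
    [:: (1, k), (1, k.+1) & rcons (nseq (1 < e) (k.+1, k.+1)) (0, k.+1)].
  rewrite /tour /detour !rcons_cat /= pairmap_cat.
  have ->: last k (nseq (0 < e) k) = k by case: (0 < e).
  rewrite pairmap_cat last_zigzag /= (uedgeC k 1).
  by case: (0 < e) (1 < e) => [] [] /=; rewrite (uedgeC k.+1 0) !uedge_le //; lia.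
rewrite /= -cats1 !count_cat /= (permP (zigzag_edges k j le_jk)) !count_cat /=; lia.
Qed.

Lemma uniq_detour k j e : e <= 2 -> j.+1.*2 <= k -> uniq (tour (detour k j e)).
Proof.
move=> e_le2 le_jk; rewrite (perm_uniq (detour_edges k j e e_le2 le_jk)).
move: j.+1.*2 le_jk => n le_nk.
rewrite !cat_uniq !map_inj_uniq ?iota_uniq; try by move=> ? ? [].
rewrite !has_cat !negb_or.
have no_loop (b : bool) x y :
    k <= x -> ~~ has [in [seq (i, y) | i <- iota 0 n]] (nseq b (x, x)).
  move=> le_kx; case: b; rewrite //= orbF; apply/mapP=> [[i]].
  by rewrite mem_iota => lt_in [eq_xi _]; lia.
rewrite !no_loop //; try lia.
have ->: ~~ has [in [seq (i, k) | i <- iota 0 n]] [seq (i, k.+1) | i <- iota 0 n].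
  by apply/hasPn=> _ /mapP[i _ ->]; apply/mapP=> -[? _ []]; lia.
by case: (0 < e) (1 < e) => [] [] //=; rewrite !inE xpair_eqE; lia.
Qed.

(** Every edge of the detour has a new vertex as its larger end; with [tour_bound], this separates
    it from the old trails. *)
Lemma detour_bound k j e p : e <= 2 -> j.+1.*2 <= k ->
  p \in tour (detour k j e) -> k <= p.2.
Proof.
move=> e_le2 le_jk; rewrite (perm_mem (detour_edges k j e e_le2 le_jk)) !mem_cat.
case/or4P=> [/mapP[i _ ->] | /mapP[i _ ->] | |] //=.
- by rewrite mem_nseq => /andP[_ /eqP->].
- by rewrite mem_nseq => /andP[_ /eqP->] /=.
Qed.

Lemma has_tours_detour k a b j e : e <= 2 -> j.+1.*2 <= k ->
  has_tours k a b -> has_tours k.+2 a (b + (4 * j.+1 + e)).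
Proof.
move=> e_le2 le_jk [s [t [sa tb /andP[lt_k u_st]]]].
(* The [0] is the return to the base vertex, where [tour_cat] cuts the trail again. *)
exists s, (detour k j e ++ 0 :: t); split=> //.
  by rewrite size_cat -(size_detour k j e e_le2) -tb /=; lia.
have k_gt0 : 0 < k by lia.
move: lt_k; rewrite all_cat => /andP[lt_sk lt_tk].
have widen w : all (gtn k) w -> all (gtn k.+2) w.
  by apply: sub_all => x /=; lia.
have lt_dk : all (gtn k.+2) (detour k j e).
  rewrite !all_cat /= !all_nseq /= !ltnS leqnn ltnW // !orbT /= andbT.
  elim: j le_jk => //= j IHj le_jk; rewrite all_cat IHj /=; lia.
apply/andP; split; first by rewrite 2!all_cat lt_dk !widen //= k_gt0.
have perm_dst : perm_eq ((0, 0) :: tour s ++ tour (detour k j e) ++ tour t)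
    (((0, 0) :: tour s ++ tour t) ++ tour (detour k j e)).
  by apply/permP=> q; rewrite /= !count_cat /= !count_cat; lia.
rewrite tour_cat (perm_uniq perm_dst) cat_uniq u_st uniq_detour // andbT.
apply/hasPn=> p /detour_bound -/(_ e_le2 le_jk) le_kp; apply/negP.
rewrite inE mem_cat => /or3P[/eqP p0 | p_s | p_t].
- by move: le_kp; rewrite p0 /=; lia.
- by have:= tour_bound k s p k_gt0 lt_sk p_s; lia.
- by have:= tour_bound k t p k_gt0 lt_tk p_t; lia.
Qed.

(** * Explicit trails for k = 6 and k = 8 *)

Fixpoint add_loops (l w : seq nat) : seq nat :=
  if w is x :: w' then
    if x \in l then [:: x, x & add_loops (rem x l) w'] else x :: add_loops l w'
  else [::].

(* The missing lengths are made up by loops, taken from the lower end of       *)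
(* [iota 1 k.-1] for [s] and from its upper end for [t].                       *)
Definition realizes (k : nat) (s t : seq nat) (a b : nat) : bool :=
  let s' := add_loops (take (a - (size s).+1) (iota 1 k.-1)) s in
  let t' := add_loops (take (b - (size t).+1) (rev (iota 1 k.-1))) t in
  [&& (size s').+1 == a, (size t').+1 == b & disjoint_tours k s' t'].

Lemma realizesP k s t a b : realizes k s t a b -> has_tours k a b.
Proof. by case/and3P=> /eqP sa /eqP tb dst; do 2!eexists; split; eauto. Qed.

(** Loopless trails of lengths (3,3), (3,6), (3,9) and (6,6), to which up to five loops are added.
    The last two pairs use all of K_6 except the perfect matching 03, 14, 25. *)
Definition tours6 : seq (seq nat * seq nat) :=
  [:: ([:: 1; 2], [:: 4; 5]); ([:: 1; 2], [:: 4; 2; 3; 1; 5]);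
      ([:: 1; 2], [:: 4; 2; 3; 1; 5; 3; 4; 5]);
      ([:: 1; 2; 3; 5; 4], [:: 2; 4; 3; 1; 5])].

Lemma has_tours6 a b : 3 <= a <= b -> a + b < 18 -> has_tours 6 a b.
Proof.
move=> /andP[a_ge3 le_ab] lt_ab.
(* The ranges cover all x <= y with 3 <= x and x + y < 18, since these force x <= 8. *)
have: all (fun x => all (fun y => has (fun st => realizes 6 st.1 st.2 x y) tours6)
        (iota x (18 - x.*2))) (iota 3 6) by vm_compute.
move=> /allP/(_ a); rewrite mem_iota => /(_ ltac:(lia))/allP/(_ b).
rewrite mem_iota => /(_ ltac:(lia))/hasP[st _]; exact: realizesP.
Qed.

Lemma has_tours8 a b : (a, b) \in [:: (14, 14); (15, 15); (15, 16)] -> has_tours 8 a b.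
Proof.
move=> ab_in; apply: (realizesP _ [:: 3; 4; 1; 6; 7; 4; 5; 2; 3; 1; 7]
  [:: 6; 3; 5; 6; 4; 2; 7; 5; 0; 1; 2]).
by move: ab_in; rewrite !inE => /or3P[] /eqP[-> ->]; vm_compute.
Qed.

(** * Induction on half the number of vertices *)

Lemma has_tours_max m a b : 3 <= m -> 3 <= a -> 3 <= b -> a + b < 2 * m ^ 2 ->
  has_tours m.*2 a b.
Proof.
move=> m_ge3; elim: m m_ge3 a b => // m IHm; rewrite leq_eqVlt => /predU1P[<- | m_ge3] a b.
  wlog le_ab : a b / a <= b => [wlog_ab | a_ge3 _ lt_ab].
    by case/orP: (leq_total a b) => le ? ? ?; last apply: has_tours_sym;
      apply: wlog_ab => //; rewrite addnC.
  by apply: has_tours6; rewrite ?a_ge3.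
wlog le_ab : a b / a <= b => [wlog_ab | a_ge3 b_ge3 lt_ab].
  by case/orP: (leq_total a b) => le ? ? ?; last apply: has_tours_sym;
    apply: wlog_ab => //; rewrite addnC.
have [small | large] := ltnP (a + b) (2 * m ^ 2).
  by apply: (has_tours_widen m.*2); [rewrite leq_double | apply: IHm].
(* The detour must absorb at least D = a + b + 1 - 2m^2 edges. It takes exactly D when D has the
   form 4(j+1) + e; otherwise D < 4, and it takes 4, or D is 3 modulo 4, and it takes D + 1. *)
have [j [e [lt_jm e_le2 le_d ge_d]]] : exists j e, [/\ j < m, e <= 2,
    (a + b).+1 <= 2 * m ^ 2 + (4 * j.+1 + e)
    & 4 * j.+1 + e <= maxn 4 ((a + b).+1 + (e == 0) - 2 * m ^ 2)].
  pose x := (a + b).+2 - 2 * m ^ 2.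
  have [x_lt4 | x_ge4] := ltnP x 4.
    by exists 0, 0; split; lia.
  by exists (x %/ 4).-1, (x %% 4).-1; split; lia.
have [b_ge | b_lt] := leqP (3 + (4 * j.+1 + e)) b.
  rewrite doubleS -(subnK (leq_trans (leq_addl 3 _) b_ge)).
  by apply: has_tours_detour => //; [lia | apply: IHm; lia].
(* Fewer than 3 edges would remain for the second trail. Then a >= 2m^2 - 4, so a + b >= 4m^2 - 8,
   which is below 2(m+1)^2 only if m < 4. *)
have m3 : m = 3 by nia.
move: lt_ab large lt_jm; rewrite m3 => lt_ab large lt_jm.
apply: has_tours8; rewrite !inE !xpair_eqE; lia.
Qed.

(** * From trails to an embedding *)

Definition petal_src c2 c3 (e : petal_edge c2 c3) : petal_vert c2 c3 :=
  match e with
  | None => None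
  | Some (inl i) => petal_u2 c2 c3 i
  | Some (inr i) => petal_u3 c2 c3 i
  end.

Definition petal_tgt c2 c3 (e : petal_edge c2 c3) : petal_vert c2 c3 :=
  match e with
  | None => None
  | Some (inl i) => petal_u2 c2 c3 i.+1
  | Some (inr i) => petal_u3 c2 c3 i.+1
  end.

Lemma petal_endsE c2 c3 (e : petal_edge c2 c3) :
  petal_ends e = [set petal_src c2 c3 e; petal_tgt c2 c3 e].
Proof. by case: e => [[]|]. Qed.

Lemma uedge_set n (x y z w : 'I_n) : [set x; y] = [set z; w] -> uedge x y = uedge z w.
Proof.
move=> /setP eq_xy_zw.
move: (eq_xy_zw x) (eq_xy_zw y) (eq_xy_zw z) (eq_xy_zw w).
rewrite !inE !eqxx -!val_eqE /= /uedge => *; congr pair; lia.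
Qed.

Lemma tours_embeddable k c2 c3 : 0 < k -> has_tours k c2 c3 ->
  embeddable (petal c2 c3) (looped_complete k).
Proof.
case: k => // k _ [s [t [<- <- {c2 c3} /andP[lt_k u_st]]]].
set c2 := (size s).+1; set c3 := (size t).+1.
pose f (v : petal_vert c2 c3) : 'I_k.+1 :=
  match v with
  | None => ord0
  | Some (inl i) => inord (nth 0 s i)
  | Some (inr i) => inord (nth 0 t i)
  end.
have lt_nth w i : all (gtn k.+1) w -> nth 0 (0 :: rcons w 0) i < k.+1.
  move=> lt_wk; have: all (gtn k.+1) (0 :: rcons w 0) by rewrite /= all_rcons lt_wk.
  by move/(all_nthP 0)/(_ i); case: ltnP => [_ /(_ isT) // | le_i _]; rewrite nth_default.
move: lt_k; rewrite all_cat => /andP[lt_sk lt_tk].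
(* Past the end of the list both sides fall back to 0, the image of u_0. *)
have f_u2 i : f (petal_u2 c2 c3 i) = nth 0 (0 :: rcons s 0) i :> nat.
  case: i => //= i; rewrite -[RHS](inordK (lt_nth s i.+1 lt_sk)) /= nth_rcons.
  case: insubP => [j -> <- //| ]; rewrite /= -leqNgt ltnNge => -> /=.
  by rewrite if_same inordK.
have f_u3 i : f (petal_u3 c2 c3 i) = nth 0 (0 :: rcons t 0) i :> nat.
  case: i => //= i; rewrite -[RHS](inordK (lt_nth t i.+1 lt_tk)) /= nth_rcons.
  case: insubP => [j -> <- //| ]; rewrite /= -leqNgt ltnNge => -> /=.
  by rewrite if_same inordK.
(* The position of the image of [e] in the duplicate-free list of used edges, whose head is the loop
   at 0; injectivity on edges reduces to injectivity of [pos]. *)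
pose pos (e : petal_edge c2 c3) : nat :=
  match e with None => 0 | Some (inl i) => i.+1 | Some (inr i) => (c2 + i).+1 end.
have pos_lt e : pos e < size ((0, 0) :: tour s ++ tour t).
  case: e => [[i|i]|] //=; rewrite size_cat !size_tour ltnS ?ltn_add2l //.
  by rewrite (leq_trans (ltn_ord i)) // leq_addr.
have pos_inj : injective pos.
  move=> [[i|i]|] [[j|j]|] //= [eq_ij].
  - by congr (Some (inl _)); apply: val_inj.
  - by have:= ltn_ord i; rewrite eq_ij; lia.
  - by have:= ltn_ord j; rewrite -eq_ij; lia.
  - by congr (Some (inr _)); apply: val_inj; apply: addnI eq_ij.
have nth_pos e : nth (0, 0) ((0, 0) :: tour s ++ tour t) (pos e)
    = uedge (f (petal_src c2 c3 e)) (f (petal_tgt c2 c3 e)).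
  case: e => [[i|i]|]; rewrite /petal_src /petal_tgt ?f_u2 ?f_u3 //.
    rewrite [LHS]/= nth_cat size_tour ltn_ord.
    by rewrite (nth_pairmap 0) ?size_rcons.
  rewrite [LHS]/= nth_cat size_tour ltnNge leq_addr addKn /=.
  by rewrite (nth_pairmap 0) ?size_rcons.
have phiP (e : petal_edge c2 c3) : 0 < #|f @: petal_ends e| <= 2.
  by rewrite petal_endsE imsetU !imset_set1 cards2; case: eqP.
exists f, (fun e => exist _ (f @: petal_ends e) (phiP e)) => // d e [].
rewrite !petal_endsE !imsetU !imset_set1 => /uedge_set; rewrite -!nth_pos.
by move/eqP; rewrite nth_uniq // => /eqP/pos_inj.
Qed.

(** * Necessity by counting degrees *)

(** On a closed walk each visit is the source of one step and the target of another. *)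
Lemma sum_closed_walk (F : nat -> nat) n : F 0 = F n ->
  \sum_(i < n) (F i + F i.+1) = (\sum_(i < n) F i).*2.
Proof.
move=> F0n; rewrite big_split /= -addnn; congr addn; apply: (@addnI (F 0)).
by rewrite -(big_ord_recl n (fun i => F i)) big_ord_recr /= F0n addnC.
Qed.

(** There are k possible end sets {v, w}, the loop included; the loop's second incidence accounts
    for the extra 1. *)
Lemma degree_bound (I : finType) k (a b : I -> 'I_k) (v : 'I_k) :
  injective (fun e => [set a e; b e]) ->
  \sum_e ((a e == v) + (b e == v)) <= k.+1.
Proof.
move=> inj_ab; set g := fun e => [set a e; b e] in inj_ab.
apply: (@leq_trans (\sum_e ((v \in g e) + (g e == [set v])))).
  apply: leq_sum => e _; rewrite /g !inE ![v == _]eq_sym.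
  by case: (a e =P v) (b e =P v) => [-> | _] [-> | _] //=; rewrite setUid eqxx.
rewrite big_split /= -addn1 leq_add //.
  rewrite -big_mkcond sum1_card -(card_imset _ inj_ab).
  apply: leq_trans (leq_trans (leq_imset_card (fun w => [set v; w]) 'I_k) _).
    apply/subset_leq_card/subsetP=> _ /imsetP[e v_e ->].
    have: v \in g e := v_e; case/set2P=> ->; apply/imsetP; first by exists (b e).
    by exists (a e); rewrite // /g setUC.
  by rewrite card_ord.
rewrite -big_mkcond sum1_card -(card_imset _ inj_ab) -(cards1 [set v]).
apply/subset_leq_card/subsetP=> _ /imsetP[e e_v ->].
have /eqP -> : g e == [set v] by exact: e_v.
by rewrite set11.
Qed.

Lemma sum_option (T : finType) (F : option T -> nat) :
  \sum_x F x = F None + \sum_x F (Some x).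
Proof.
have perm_opt : perm_eq (index_enum (option T)) (None :: map some (enum T)).
  apply: uniq_perm; rewrite ?index_enum_uniq //=.
    by rewrite map_inj_uniq ?enum_uniq ?andbT; [apply/mapP=> -[] | move=> ? ? []].
  move=> x; rewrite mem_index_enum inE; case: x => //= x.
  by rewrite mem_map ?mem_enum // => ? ? [].
by rewrite (perm_big _ perm_opt) big_cons big_map big_enum.
Qed.

Lemma embeddable_petal_bound k c2 c3 : 0 < k -> ~~ odd k -> 0 < c2 -> 0 < c3 ->
  embeddable (petal c2 c3) (looped_complete k) ->
  [/\ 6 <= k, 3 <= c2 & 1 + c2 + c3 <= k ^ 2 %/ 2].
Proof.
move=> k_gt0 k_even c2_gt0 c3_gt0 [f [phi ends_phi phi_inj]].
have u2_end : petal_u2 c2 c3 c2 = None.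
  by case: c2 c2_gt0 {f phi ends_phi phi_inj} => //= n _; rewrite insubF ?ltnn.
have u3_end : petal_u3 c2 c3 c3 = None.
  by case: c3 c3_gt0 {f phi ends_phi phi_inj u2_end} => //= n _; rewrite insubF ?ltnn.
have ends_inj (d e : petal_edge c2 c3) : f @: petal_ends d = f @: petal_ends e -> d = e.
  by move=> eq_de; apply/phi_inj/val_inj; rewrite -[LHS]ends_phi -[RHS]ends_phi in eq_de *.
pose visits (v : 'I_k) := (f None == v) + \sum_(i < c2) (f (petal_u2 c2 c3 i) == v)
  + \sum_(i < c3) (f (petal_u3 c2 c3 i) == v).
have visits_degree v :
    (visits v).*2 = \sum_e ((f (petal_src c2 c3 e) == v) + (f (petal_tgt c2 c3 e) == v)).
  rewrite sum_option big_sumType /= addnn !doubleD -addnA; congr (_ + (_ + _)).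
    by rewrite (sum_closed_walk (fun i => f (petal_u2 c2 c3 i) == v)) ?u2_end.
  by rewrite (sum_closed_walk (fun i => f (petal_u3 c2 c3 i) == v)) ?u3_end.
have visits_le v : visits v <= k./2.
  suff: (visits v).*2 <= k.+1 by lia.
  rewrite visits_degree degree_bound // => d e eq_de; apply: ends_inj.
  by rewrite !petal_endsE !imsetU !imset_set1.
have visits_u0 : 3 <= visits (f None).
  (* The three visits are the loop and index 0 of each cycle. *)
  rewrite /visits (bigD1 (Ordinal c2_gt0)) //= (bigD1 (Ordinal c3_gt0)) //=.
  by rewrite !eqxx; lia.
have sum_visits : \sum_v visits v = 1 + c2 + c3.
  have sum_eq (w : 'I_k) : \sum_v (w == v) = 1.
    by rewrite (bigD1 w) //= eqxx big1 // => v; rewrite eq_sym => /negPf->.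
  have sum_walk n (g : 'I_n -> 'I_k) : \sum_v \sum_(i < n) (g i == v) = n.
    by rewrite exchange_big (eq_bigr (fun=> 1)) // sum1_card card_ord.
  by rewrite 2!big_split /= sum_eq !sum_walk.
split.
- by have := leq_trans visits_u0 (visits_le _); lia.
(* A cycle of length 1 would be a second loop at u_0, and one of length 2 a pair of parallel edges;
   both contradict injectivity on edges. *)
- case: leqP => // c2_lt3; pose i0 := Ordinal c2_gt0.
  have [c2_1 | c2_2] : c2 = 1 \/ c2 = 2 by lia.
    have u2_1 : petal_u2 c2 c3 i0.+1 = None.
      by rewrite -[RHS]u2_end [X in _ = petal_u2 _ _ X]c2_1.
    suff: None = Some (inl i0) :> petal_edge c2 c3 by [].
    by apply: ends_inj; rewrite /petal_ends u2_1.
  have lt1c2 : 1 < c2 by rewrite c2_2.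
  pose i1 := Ordinal lt1c2.
  have u2_2 : petal_u2 c2 c3 i1.+1 = None.
    by rewrite -[RHS]u2_end [X in _ = petal_u2 _ _ X]c2_2.
  suff: Some (inl i0) = Some (inl i1) :> petal_edge c2 c3 by [].
  by apply: ends_inj; rewrite /petal_ends u2_2 setUC.
- rewrite -sum_visits (@leq_trans (\sum_(v < k) k./2)) ?leq_sum //.
  rewrite sum_nat_const card_ord; nia.
Qed.

Theorem theorem3p1 (k c2 c3 : nat) (k_gt0 : 0 < k) (k_even : ~~ odd k)
    (c2_gt0 : 0 < c2) (c3_gt0 : 0 < c3) (le_c2_c3 : c2 <= c3) :
  embeddable (petal c2 c3) (looped_complete k) <->
  [/\ 6 <= k, 3 <= c2 & 1 + c2 + c3 <= k ^ 2 %/ 2].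
Proof.
split=> [|[k_ge6 c2_ge3 le_k]]; first exact: embeddable_petal_bound.
apply: tours_embeddable => //; rewrite -(even_halfK k_even).
apply: has_tours_max; [lia | lia | lia |].
move: le_k; rewrite -{1}(even_halfK k_even) -muln2 expnMn; lia.
Qed.
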